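(* Let $N\ge1$ and $m\ge 1$ be integers, $\beta>0$, and let $x_0\in\mathbb{R}^{r_0}$, $A_j\in\mathbb{R}^{r_j\times r_{j-1}}$, $B_j\in\mathbb{R}^{r_j\times s_j}$, $c_j\in\mathbb{R}^{r_j}$, $j=1,\dots,N+1$, be given. Suppose that $\mu_w>0$. Then the point $z=(w,x)$, with $w=(w_1,\dots,w_{N+1})$ and $x=(x_1,\dots,x_N)$, generated by the forward dynamic programming algorithm described in the context is the unique minimizer, over $w_j\in\mathbb{R}^{s_j}$ and $x_j\in\mathbb{R}^{r_j}$, of $$\mathcal{G}(z)=\sum_{j=1}^{N+1}\Big(\tfrac{\rho_j}{2}\|\delta_jx_j-A_jx_{j-1}-B_jw_j-c_j\|^2+\tfrac{\mu_w}{2}\|w_j\|^2\Big),$$ where $(\delta_j,\rho_j)=(1,\beta)$ for $j\le N$ and $(\delta_{N+1},\rho_{N+1})=(0,\tfrac1m)$ (so the term $\delta_{N+1}x_{N+1}$ is absent).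
   Context: $\|\cdot\|$ is the Euclidean norm and $\mathrm{I}$ an identity matrix of appropriate size. For $j=1,\dots,N+1$ define $$E_j=\big(\tfrac{\mu_w}{\rho_j}\mathrm{I}+B_j^\top B_j\big)^{-1}B_j^\top,\qquad G_j=\mathrm{I}-B_jE_j,$$ $$M_1=\tfrac1{\rho_1}\mathrm{I}+\tfrac1{\mu_w}B_1B_1^\top,\qquad M_j=\tfrac1{\rho_j}\mathrm{I}+\tfrac1{\mu_w}B_jB_j^\top+A_jM_{j-1}A_j^\top\quad (j>1),$$ $$S_1=\mathrm{I}_{r_0},\qquad S_j=M_{j-1}-M_{j-1}A_j^\top M_j^{-1}A_jM_{j-1}\quad (j>1).$$ (The matrices $M_j$ are symmetric positive definite, hence invertible.) Forward dynamic programming algorithm. Set $q_0=x_0$. Forward recursion: for $j=1,\dots,N$ compute, in order, $\tilde c_j=M_j^{-1}c_j$, $\ \tilde q_j=S_jq_{j-1}$, $\ q_j=\rho_jG_jA_j\tilde q_j+\tilde c_j$, and $M_{j+1}$ from the formula above. Backward recursion: (a) $\tilde x_{N+1}=-S_{N+1}\big(A_{N+1}^\top G_{N+1}c_{N+1}\big)$ and $\tilde q_{N+1}=S_{N+1}q_N$; (b) $x_N=\tilde q_{N+1}+\rho_{N+1}\tilde x_{N+1}$ and $w_{N+1}=-E_{N+1}\big(A_{N+1}x_N+c_{N+1}\big)$; (c) for $j=N,N-1,\dots,2$: $\ \tilde x_j=S_j\big(A_j^\top G_j(x_j-c_j)\big)$, $\ x_{j-1}=\tilde q_j+\rho_j\tilde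 x_j$, $\ w_j=E_j\big(x_j-A_jx_{j-1}-c_j\big)$; (d) $w_1=E_1\big(x_1-A_1x_0-c_1\big)$. The output is $z=(w,x)$. *)

(* Defs.v *)
From mathcomp Require Import all_boot all_order all_algebra.
From mathcomp Require Import reals.

Set Implicit Arguments.
Unset Strict Implicit.
Unset Printing Implicit Defensive.

Import Order.TTheory GRing.Theory Num.Theory.
Local Open Scope ring_scope.

Definition enorm (R : realType) (n : nat) (v : 'cV[R]_n) : R :=
  Num.sqrt (\sum_i v i 0 ^+ 2).

Definition minimizer (R : realType) (T : Type) (f : T -> R) (z : T) : Prop :=
  forall z', f z <= f z'.

Section ForwardDynamicProgramming.

(* The families r, s, A, B, c are indexed as in the mathematics: A j, B j, c j
   stand for A_j, B_j, c_j, and only the values with 1 <= j <= N+1 (0 <= j for r)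
   are ever used.  Since (k.+1).-1 reduces to k, A k.+1 is an
   r k.+1 by r k matrix without any cast. *)
Variables (R : realType) (N m : nat) (r s : nat -> nat) (beta mu : R).
Variable x0 : 'cV[R]_(r 0%N).
Variable A : forall j : nat, 'M[R]_(r j, r j.-1).
Variable B : forall j : nat, 'M[R]_(r j, s j).
Variable c : forall j : nat, 'cV[R]_(r j).

Definition delta (j : nat) : R := if (j <= N)%N then 1 else 0.

Definition rho (j : nat) : R := if (j <= N)%N then beta else m%:R^-1.

(* A point z = (w, x).  Finite types are 0-based, so z.1 i is w_{i+1}
   (i = 0, ..., N) and z.2 i is x_{i+1} (i = 0, ..., N-1). *)
Definition point : Type :=
  ({dffun forall i : 'I_N.+1, 'cV[R]_(s i.+1)} *
   {dffun forall i : 'I_N, 'cV[R]_(r i.+1)})%type.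

(* The sequence x_0, x_1, ..., x_N, with the given x_0 at index 0; the value at
   an index j > N is a dummy. *)
Definition state (z : point) (j : nat) : 'cV[R]_(r j) :=
  match j return 'cV[R]_(r j) with
  | 0 => x0
  | k.+1 => if @idP (k < N)%N is ReflectT kN then z.2 (Ordinal kN) else 0
  end.

Definition objective (z : point) : R :=
  \sum_(i < N.+1)
    (rho i.+1 / 2 *
       enorm (delta i.+1 *: state z i.+1 - A i.+1 *m state z i
              - B i.+1 *m z.1 i - c i.+1) ^+ 2
     + mu / 2 * enorm (z.1 i) ^+ 2).

Definition Emx (j : nat) : 'M[R]_(s j, r j) :=
  invmx ((mu / rho j)%:M + (B j)^T *m B j) *m (B j)^T.

Definition Gmx (j : nat) : 'M[R]_(r j) := 1%:M - B j *m Emx j.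

(* M_j for j >= 1; the value at j = 0 is a dummy. *)
Fixpoint Mmx (j : nat) : 'M[R]_(r j) :=
  match j return 'M[R]_(r j) with
  | 0 => 0
  | k.+1 =>
    let M1 := ((rho k.+1)^-1)%:M + mu^-1 *: (B k.+1 *m (B k.+1)^T) in
    if k == 0%N then M1 else M1 + A k.+1 *m Mmx k *m (A k.+1)^T
  end.

(* S_j for j >= 1; the value at j = 0 is a dummy. *)
Definition Smx (j : nat) : 'M[R]_(r j.-1) :=
  if (j <= 1)%N then 1%:M
  else Mmx j.-1 - Mmx j.-1 *m (A j)^T *m invmx (Mmx j) *m A j *m Mmx j.-1.

Definition ctilde (j : nat) : 'cV[R]_(r j) := invmx (Mmx j) *m c j.

Fixpoint q (j : nat) : 'cV[R]_(r j) :=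
  match j return 'cV[R]_(r j) with
  | 0 => x0
  | k.+1 =>
    let qt := Smx k.+1 *m q k in
    rho k.+1 *: (Gmx k.+1 *m A k.+1 *m qt) + ctilde k.+1
  end.

Definition qtilde (j : nat) : 'cV[R]_(r j.-1) := Smx j *m q j.-1.

Definition xtilde (j : nat) (xj : 'cV[R]_(r j)) : 'cV[R]_(r j.-1) :=
  Smx j *m ((A j)^T *m (Gmx j *m (xj - c j))).

Definition xtilde_last : 'cV[R]_(r N) :=
  - (Smx N.+1 *m ((A N.+1)^T *m (Gmx N.+1 *m c N.+1))).

Definition x_last : 'cV[R]_(r N) :=
  qtilde N.+1 + rho N.+1 *: xtilde_last.

Definition start : forall i : nat, 'cV[R]_(r i) :=
  @dfwith nat (fun i => 'cV[R]_(r i)) (fun=> 0) 0%N x0.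

(* backward j xj is the sequence x_0, ..., x_{j-1}, x_j = xj obtained by running
   the backward recursion down to x_1; index 0 holds the given x_0 (which is not
   recomputed), and the values beyond index j are dummies. *)
Fixpoint backward (j : nat) : 'cV[R]_(r j) -> forall i : nat, 'cV[R]_(r i) :=
  match j return 'cV[R]_(r j) -> forall i : nat, 'cV[R]_(r i) with
  | 0 => fun _ => start
  | k.+1 => fun xj =>
    @dfwith nat (fun i => 'cV[R]_(r i))
      (if (0 < k)%N
       then backward (qtilde k.+1 + rho k.+1 *: xtilde xj : 'cV[R]_(r k))
       else start) k.+1 xj
  end.

Definition fdp_x (j : nat) : 'cV[R]_(r j) := backward x_last j.

Definition fdp_w (j : nat) : 'cV[R]_(s j) :=
  if j == N.+1 then - (Emx j *m (A j *m fdp_x j.-1 + c j))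
  else Emx j *m (fdp_x j - A j *m fdp_x j.-1 - c j).

Definition fdp_output : point :=
  (finfun (fun i : 'I_N.+1 => fdp_w i.+1),
   finfun (fun i : 'I_N => fdp_x i.+1)).

End ForwardDynamicProgramming.

(* Main.v *)
Require Import Defs.
From mathcomp Require Import all_boot all_order all_algebra.
From mathcomp Require Import reals.
From mathcomp Require Import ring lra.

(* The objective is a convex quadratic with positive semidefinite second-order
   part, so it suffices to show that the algorithm produces a stationary point
   and that the second-order part has trivial kernel.  Write P_j for
   rho_j^-1 I + mu^-1 B_j B_j^T, so that rho_j G_j = P_j^-1 and
   M_j = P_j + A_j M_{j-1} A_j^T.  Minimizing over w_j leaves the weighted
   residual p_j = P_j^-1 (delta_j x_j - A_j x_{j-1} - c_j), and stationarity in
   x_j reads p_j = A_{j+1}^T p_{j+1}.  By the Woodbury identity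
   S_j = (M_{j-1}^-1 + A_j^T P_j^-1 A_j)^-1, both sides equal
   M_j^-1 x_j - q_j: the right-hand side because of the backward step producing
   x_j, the left-hand side because of the one producing x_{j-1} and the
   recursion for q_j. *)

Set Implicit Arguments.
Unset Strict Implicit.
Unset Printing Implicit Defensive.

Import Order.TTheory GRing.Theory Num.Theory.
Local Open Scope ring_scope.

(** * Dot products and positive definite matrices *)

Definition dotmx (R : pzRingType) (n : nat) (u v : 'cV[R]_n) : R :=
  (u^T *m v) 0 0.

Definition posdefmx (R : numDomainType) (n : nat) (M : 'M[R]_n) : Prop :=
  forall v : 'cV[R]_n, v != 0 -> 0 < dotmx v (M *m v).

Section DotProduct.

Variable R : comPzRingType.

Lemma dotmxE n (u v : 'cV[R]_n) : dotmx u v = \sum_i u i 0 * v i 0.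
Proof. by rewrite /dotmx mxE; apply: eq_bigr => i _; rewrite mxE. Qed.

Lemma dotmxC n (u v : 'cV[R]_n) : dotmx u v = dotmx v u.
Proof. by rewrite !dotmxE; apply: eq_bigr => i _; rewrite mulrC. Qed.

Lemma dotmxDr n (u v w : 'cV[R]_n) : dotmx u (v + w) = dotmx u v + dotmx u w.
Proof. by rewrite /dotmx mulmxDr mxE. Qed.

Lemma dotmxZr n a (u v : 'cV[R]_n) : dotmx u (a *: v) = a * dotmx u v.
Proof. by rewrite /dotmx -scalemxAr mxE. Qed.

Lemma dotmxBr n (u v w : 'cV[R]_n) : dotmx u (v - w) = dotmx u v - dotmx u w.
Proof. by rewrite dotmxDr -scaleN1r dotmxZr mulN1r. Qed.

Lemma dotmxDl n (u v w : 'cV[R]_n) : dotmx (v + w) u = dotmx v u + dotmx w u.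
Proof. by rewrite dotmxC dotmxDr !(dotmxC u). Qed.

Lemma dotmxZl n a (u v : 'cV[R]_n) : dotmx (a *: u) v = a * dotmx u v.
Proof. by rewrite dotmxC dotmxZr dotmxC. Qed.

Lemma dotmx0r n (u : 'cV[R]_n) : dotmx u 0 = 0.
Proof. by rewrite /dotmx mulmx0 mxE. Qed.

Lemma dotmx_trmul k n (C : 'M[R]_(k, n)) u v :
  dotmx u (C *m v) = dotmx (C^T *m u) v.
Proof. by rewrite /dotmx trmx_mul trmxK mulmxA. Qed.

Lemma dotmx_sqD n (u v : 'cV[R]_n) :
  dotmx (u + v) (u + v) = dotmx u u + 2 * dotmx u v + dotmx v v.
Proof. by rewrite dotmxDl !dotmxDr (dotmxC v u); ring. Qed.

End DotProduct.

Section PositiveDefinite.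

Variable R : realFieldType.

Lemma dotmx_ge0 n (u : 'cV[R]_n) : 0 <= dotmx u u.
Proof. by rewrite dotmxE; apply: sumr_ge0 => i _; rewrite -expr2 sqr_ge0. Qed.

Lemma dotmx_eq0 n (u : 'cV[R]_n) : dotmx u u = 0 -> u = 0.
Proof.
rewrite dotmxE => /eqP; rewrite psumr_eq0 => [/allP u0|i _]; last first.
  by rewrite -expr2 sqr_ge0.
apply/matrixP=> i j; rewrite ord1 mxE.
by have := u0 i (mem_index_enum i); rewrite implyTb mulf_eq0 orbb => /eqP.
Qed.

Lemma dotmx_gt0 n (u : 'cV[R]_n) : u != 0 -> 0 < dotmx u u.
Proof.
by rewrite lt0r dotmx_ge0 andbT; apply: contra_neq => /dotmx_eq0.
Qed.

(** A nonzero row of the kernel of [M^T] transposes to a nonzero [v] with [M *m v = 0], against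
    positivity. *)
Lemma posdefmx_unit n (M : 'M[R]_n) : posdefmx M -> M \in unitmx.
Proof.
move=> Mpos; rewrite -unitmx_tr -row_free_unit -kermx_eq0.
apply/eqP/row_matrixP=> i; rewrite row0; apply/eqP/negPn/negP => ki_neq0.
have kiM : row i (kermx M^T) *m M^T = 0 by rewrite -row_mul mulmx_ker row0.
have := Mpos (row i (kermx M^T))^T; rewrite trmx_eq0 => /(_ ki_neq0).
have -> : M *m (row i (kermx M^T))^T = 0.
  by rewrite -[LHS]trmxK trmx_mul trmxK kiM trmx0.
by rewrite dotmx0r ltxx.
Qed.

Lemma dotmx_gram_ge0 k n (C : 'M[R]_(n, k)) v : 0 <= dotmx v (C *m C^T *m v).
Proof. by rewrite -mulmxA dotmx_trmul dotmx_ge0. Qed.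

Lemma posdefmxD_scalar_gram k n a b (C : 'M[R]_(n, k)) :
  0 < a -> 0 <= b -> posdefmx (a%:M + b *: (C *m C^T)).
Proof.
move=> a_gt0 b_ge0 v v_neq0.
rewrite mulmxDl dotmxDr mul_scalar_mx dotmxZr -scalemxAl dotmxZr.
by rewrite ltr_wpDr ?mulr_gt0 ?dotmx_gt0 // mulr_ge0 ?dotmx_gram_ge0.
Qed.

Lemma posdefmxD_congr k n (M : 'M[R]_k) (P : 'M[R]_n) (A : 'M_(n, k)) :
  posdefmx M -> posdefmx P -> posdefmx (P + A *m M *m A^T).
Proof.
move=> Mpos Ppos v v_neq0; rewrite mulmxDl dotmxDr ltr_wpDr ?Ppos //.
rewrite -!mulmxA dotmx_trmul.
have [->|/Mpos/ltW//] := eqVneq (A^T *m v) 0.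
by rewrite mulmx0 dotmx0r.
Qed.

End PositiveDefinite.

(** * Matrix identities of Woodbury type *)

Section MatrixIdentities.

Variable F : fieldType.

(** For [a = mu] and [b = rho j] this gives $\rho_jG_j=P_j^{-1}$. Writing [B^T *m B] as
    [K - (a / b)%:M] cancels [invmx K] in the product with [P]; a left inverse of a square matrix is
    its inverse. *)
Lemma scale_gain_invmx k n (a b : F) (B : 'M[F]_(n, k)) :
  let K := (a / b)%:M + B^T *m B in
  a != 0 -> b != 0 -> K \in unitmx ->
  b *: (1%:M - B *m (invmx K *m B^T)) = invmx (b^-1%:M + a^-1 *: (B *m B^T)).
Proof.
move=> K a0 b0 Ku; set P := b^-1%:M + _.
have BB : B^T *m B = K - (a / b)%:M by rewrite /K addrC addKr.
have GP : (b *: (1%:M - B *m (invmx K *m B^T))) *m P = 1%:M.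
  have h1 : B *m (invmx K *m B^T) *m (B *m B^T)
      = B *m B^T - (a / b) *: (B *m (invmx K *m B^T)).
    rewrite -!mulmxA (mulmxA B^T) BB mulmxBl mul_scalar_mx !mulmxBr.
    by rewrite mulKmx // -!scalemxAr.
  rewrite /P mulmxDr mul_mx_scalar scalerA mulVf // scale1r -scalemxAr.
  rewrite -scalemxAl mulmxBl mul1mx h1 opprB addrCA subrr addr0 !scalerA.
  have -> : a^-1 * b * (a / b) = 1 by field; rewrite a0 b0.
  by rewrite scale1r subrK.
have [_ Pu] := mulmx1_unit GP.
by rewrite -[LHS](mulmxK Pu) GP mul1mx.
Qed.

Variables (k n : nat) (M : 'M[F]_k) (P : 'M[F]_n) (A : 'M[F]_(n, k)).

Let M' := P + A *m M *m A^T.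
Let S := M - M *m A^T *m invmx M' *m A *m M.

Hypotheses (Pu : P \in unitmx) (M'u : M' \in unitmx).

(** Since $AMA^\top=M'-P$, the product $AS$ collapses to $PM'^{-1}AM$. *)
Lemma woodbury_push : invmx P *m A *m S = invmx M' *m A *m M.
Proof.
have AS : A *m S = P *m invmx M' *m A *m M.
  rewrite mulmxBr !mulmxA.
  have -> : A *m M *m A^T = M' - P by rewrite /M' addrC addKr.
  by rewrite !mulmxBl mulmxV // mul1mx opprB addrC subrK.
by rewrite -[LHS]mulmxA AS !mulmxA mulVmx // mul1mx.
Qed.

(** Eliminates the previous state [x], given by a backward step, from a weighted residual. After
    [woodbury_push], $AMA^\top=M'-P$ cancels the bare term $P^{-1}u$. *)
Lemma woodbury_residual (u : 'cV_n) (q x : 'cV_k) :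
  x = S *m (q + A^T *m (invmx P *m u)) ->
  invmx P *m (u - A *m x) = invmx M' *m u - invmx M' *m A *m M *m q.
Proof.
move=> ->; set y := invmx P *m u.
have push v : invmx P *m (A *m (S *m v)) = invmx M' *m A *m M *m v.
  by rewrite !mulmxA woodbury_push.
rewrite mulmxBr push mulmxDr opprD addrA addrAC; congr (_ - _).
have -> : invmx M' *m A *m M *m (A^T *m y) = invmx M' *m ((M' - P) *m y).
  by rewrite /M' [P + _]addrC addrK !mulmxA.
by rewrite mulmxBl mulmxBr mulKmx // mulKVmx // subKr.
Qed.

(** With $v=q+A^\top P^{-1}u$, both sides equal $A^\top P^{-1}u-A^\top M'^{-1}AMv$. *)
Lemma woodbury_adjoint (u : 'cV_n) (q x : 'cV_k) : M \in unitmx ->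
  x = S *m (q + A^T *m (invmx P *m u)) ->
  A^T *m (invmx P *m (u - A *m x)) = invmx M *m x - q.
Proof.
move=> Mu ->; set y := invmx P *m u; set v := q + _.
have -> : invmx P *m (u - A *m (S *m v)) = y - invmx M' *m A *m M *m v.
  rewrite mulmxBr (mulmxA A) (mulmxA (invmx P)) (mulmxA (invmx P)).
  by rewrite woodbury_push.
have -> : invmx M *m (S *m v) = v - A^T *m (invmx M' *m A *m M *m v).
  rewrite mulmxA mulmxBr mulVmx // mulmxBl mul1mx -!(mulmxA M) mulKmx //.
  by rewrite !mulmxA.
have vq : v - q = A^T *m y by rewrite /v addrC addKr.
by rewrite mulmxBr addrAC vq.
Qed.

End MatrixIdentities.

Lemma enorm_sqr (R : realType) n (v : 'cV[R]_n) : enorm v ^+ 2 = dotmx v v.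
Proof.
rewrite dotmxE /enorm sqr_sqrtr; first by apply: eq_bigr => i _; rewrite expr2.
by apply: sumr_ge0 => i _; rewrite sqr_ge0.
Qed.

(** * The matrices and the forward recursion *)

Section Stationarity.

Variables (R : realType) (N m : nat) (r s : nat -> nat) (beta mu : R).
Variable x0 : 'cV[R]_(r 0%N).
Variable A : forall j : nat, 'M[R]_(r j, r j.-1).
Variable B : forall j : nat, 'M[R]_(r j, s j).
Variable c : forall j : nat, 'cV[R]_(r j).

Hypotheses (N_gt0 : (0 < N)%N) (m_gt0 : (0 < m)%N).
Hypotheses (beta_gt0 : 0 < beta) (mu_gt0 : 0 < mu).

Local Notation delta := (delta R N).
Local Notation rho := (rho N m beta).
Local Notation Emx := (Emx N m beta mu B).
Local Notation Gmx := (Gmx N m beta mu B).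
Local Notation Mmx := (Mmx N m beta mu A B).
Local Notation Smx := (Smx N m beta mu A B).
Local Notation q := (q N m beta mu x0 A B c).
Local Notation qtilde := (qtilde N m beta mu x0 A B c).
Local Notation xtilde := (xtilde N m beta mu A B c).
Local Notation backward := (backward N m beta mu x0 A B c).
Local Notation x := (fdp_x N m beta mu x0 A B c).
Local Notation w := (fdp_w N m beta mu x0 A B c).
Local Notation state := (state x0).

Definition Pmx (j : nat) : 'M[R]_(r j) :=
  ((rho j)^-1)%:M + mu^-1 *: (B j *m (B j)^T).

Lemma rho_gt0 j : 0 < rho j.
Proof. by rewrite /Defs.rho; case: ifP => // _; rewrite invr_gt0 ltr0n. Qed.

Lemma Pmx_posdef j : posdefmx (Pmx j).
Proof.
by apply: posdefmxD_scalar_gram; rewrite ?invr_ge0 ?invr_gt0 ?rho_gt0 // ltW.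
Qed.

Lemma MmxS k : (0 < k)%N ->
  Mmx k.+1 = Pmx k.+1 + A k.+1 *m Mmx k *m (A k.+1)^T.
Proof. by case: k. Qed.

Lemma Mmx_posdef k : posdefmx (Mmx k.+1).
Proof.
elim: k => [|k IHk]; first exact: Pmx_posdef.
by rewrite MmxS //; apply: posdefmxD_congr => //; apply: Pmx_posdef.
Qed.

Lemma gain_unitmx j : (mu / rho j)%:M + (B j)^T *m B j \in unitmx.
Proof.
apply: posdefmx_unit; rewrite -[X in _ + X]scale1r -[X in _ *m X]trmxK.
by apply: posdefmxD_scalar_gram; rewrite ?divr_gt0 ?rho_gt0.
Qed.

Lemma scale_Gmx j : rho j *: Gmx j = invmx (Pmx j).
Proof.
by apply: scale_gain_invmx; rewrite ?gain_unitmx // gt_eqF // rho_gt0.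
Qed.

Lemma SmxS k : (0 < k)%N ->
  Smx k.+1 = Mmx k - Mmx k *m (A k.+1)^T *m invmx (Mmx k.+1) *m A k.+1 *m Mmx k.
Proof. by case: k. Qed.

(** Puts the forward recursion in the form produced by [woodbury_residual]. Index 1 is excluded
    because [Smx 1] is the identity, not a Woodbury expression. *)
Lemma qS k : (0 < k)%N ->
  q k.+1 = invmx (Mmx k.+1) *m A k.+1 *m Mmx k *m q k
           + invmx (Mmx k.+1) *m c k.+1.
Proof.
move=> k_gt0; rewrite [LHS]/=; congr (_ + _).
have Mu := posdefmx_unit (@Mmx_posdef k).
rewrite -mulmxA scalemxAl scale_Gmx SmxS // MmxS // in Mu *.
by rewrite !mulmxA woodbury_push // posdefmx_unit //; apply: Pmx_posdef.
Qed.

(** * The backward recursion *)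

Lemma backward_top j (y : 'cV[R]_(r j)) : (0 < j)%N -> backward y j = y.
Proof. by case: j y => // j y _; rewrite /= dfwith_in. Qed.

Lemma backward_init j (y : 'cV[R]_(r j)) : backward y 0 = x0.
Proof.
elim: j y => [|j IHj] y /=; first by rewrite /start dfwith_in.
by rewrite dfwith_out //; case: ifP => // _; rewrite /start dfwith_in.
Qed.

Lemma backward_step j k (y : 'cV[R]_(r j)) : (0 < k < j)%N ->
  backward y k = qtilde k.+1 + rho k.+1 *: xtilde (backward y k.+1).
Proof.
elim: j y => [|j IHj] y /andP[k_gt0]; first by rewrite ltn0.
(* Either [k] lies just below the top index, or both [k] and [k.+1] are read from the inner call. *)
rewrite ltnS leq_eqVlt => /predU1P[ekj|ltkj].
  rewrite -{}ekj in IHj y *; rewrite backward_top //=.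
  rewrite dfwith_out ?k_gt0 ?gtn_eqF //.
  by rewrite backward_top.
have j_gt0 : (0 < j)%N by apply: leq_ltn_trans ltkj.
rewrite /= j_gt0 !dfwith_out ?IHj ?k_gt0 //; first by rewrite gtn_eqF.
by rewrite gtn_eqF // ltnS ltnW.
Qed.

(** One formula for the initial and the later backward steps: at [k = N] the factor [delta N.+1 = 0]
    removes the dummy [x N.+1] and leaves [- c N.+1]. *)
Lemma fdp_x_step k : (0 < k <= N)%N ->
  x k = Smx k.+1 *m (q k + (A k.+1)^T *m
          (invmx (Pmx k.+1) *m (delta k.+1 *: x k.+1 - c k.+1))).
Proof.
move=> /andP[k_gt0].
rewrite -scale_Gmx -scalemxAl -scalemxAr mulmxDr -scalemxAr.
rewrite leq_eqVlt => /predU1P[->|ltkN].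
  rewrite /Defs.delta ltnn scale0r sub0r.
  have -> : x N = x_last N m beta mu x0 A B c.
    exact: backward_top.
  by rewrite /x_last /xtilde_last !mulmxN.
by rewrite /Defs.delta ltkN scale1r /fdp_x backward_step ?k_gt0.
Qed.

(** * First-order conditions at the output *)

Definition residual (j : nat) : 'cV[R]_(r j) :=
  delta j *: x j - A j *m x j.-1 - c j.

Definition multiplier (j : nat) : 'cV[R]_(r j) := invmx (Pmx j) *m residual j.

Lemma fdp_x0 : x 0 = x0.
Proof. exact: backward_init. Qed.

Lemma multiplierE k : (0 < k <= N)%N ->
  multiplier k = invmx (Mmx k) *m x k - q k.
Proof.
case: k => // k kN.
have deltak : delta k.+1 = 1 by rewrite /Defs.delta (andP kN).2.
have Pu := posdefmx_unit (@Pmx_posdef k.+1).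
have Mu := posdefmx_unit (@Mmx_posdef k).
rewrite /multiplier /residual addrAC.
case: k => [|k] in kN deltak Pu Mu *.
  (* At index 1, [Mmx 1] is [Pmx 1] and [Smx 1] is the identity, so unfolding suffices. *)
  rewrite deltak scale1r /= fdp_x0 mul1mx scalemxAl scalemxAl scale_Gmx.
  by rewrite /ctilde /= !mulmxBr mulmxA opprD addrA addrAC.
have Sk := @fdp_x_step k.+1 (ltnW kN).
rewrite (@woodbury_residual _ _ _ (Mmx k.+1) _ _ Pu _ _ (q k.+1)) -?MmxS //.
  by rewrite deltak scale1r (@qS k.+1) // mulmxBr opprD addrA addrAC.
Qed.

Lemma stationary_state k : (0 < k <= N)%N ->
  (A k.+1)^T *m multiplier k.+1 = multiplier k.
Proof.
move=> kN; rewrite (multiplierE kN) /multiplier /residual addrAC.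
have Pu := posdefmx_unit (@Pmx_posdef k.+1).
have M'u := posdefmx_unit (@Mmx_posdef k).
case: k => // k in kN Pu M'u *.
have Mu := posdefmx_unit (@Mmx_posdef k).
apply: woodbury_adjoint => //; rewrite -?MmxS //.
by rewrite -SmxS // -fdp_x_step.
Qed.

Lemma fdp_wE j : (0 < j <= N.+1)%N -> w j = Emx j *m residual j.
Proof.
move=> /andP[_]; rewrite /fdp_w /residual /Defs.delta leq_eqVlt ltnS.
have [-> _|_ /= ->] := eqVneq; last by rewrite scale1r.
by rewrite ltnn scale0r sub0r -opprD mulmxN.
Qed.

(** Subtracting [B j *m w j] amounts to applying [Gmx j], and [rho j *: Gmx j] is
    [invmx (Pmx j)]. *)
Lemma multiplier_residual j : (0 < j <= N.+1)%N ->
  multiplier j = rho j *: (residual j - B j *m w j).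
Proof.
move=> jN; rewrite fdp_wE // /multiplier -scale_Gmx -scalemxAl mulmxBl mul1mx.
by rewrite mulmxA.
Qed.

(** Stationarity in $w_j$, from the normal equation that defines [Emx j]. *)
Lemma stationary_control j : (0 < j <= N.+1)%N ->
  (B j)^T *m multiplier j = mu *: w j.
Proof.
move=> jN; rewrite multiplier_residual // -scalemxAr mulmxBr mulmxA.
have -> : (B j)^T *m residual j = ((mu / rho j)%:M + (B j)^T *m B j) *m w j.
  by rewrite fdp_wE // /Defs.Emx -mulmxA mulKVmx ?gain_unitmx.
rewrite mulmxDl addrK mul_scalar_mx scalerA mulrC divfK //.
by rewrite gt_eqF ?rho_gt0.
Qed.

(** * Exact expansion of the objective at the output *)

Local Notation point := (point R N r s).
Local Notation objective := (objective m beta mu x0 A B c).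
Local Notation output := (fdp_output N m beta mu x0 A B c).

Lemma state_output j : (j <= N)%N -> state output j = x j.
Proof.
case: j => [|j] jN; first by rewrite fdp_x0.
by rewrite /Defs.state; case: {-}_ / idP => // jN'; rewrite ffunE.
Qed.

Definition increment (z : point) (j : nat) : 'cV[R]_(r j) := state z j - x j.

(** The linear part of the penalized residual, taken at the displacement of [z] from the output. *)
Definition defect (z : point) (i : 'I_N.+1) : 'cV[R]_(r i.+1) :=
  delta i.+1 *: increment z i.+1 - A i.+1 *m increment z i
  - B i.+1 *m (z.1 i - w i.+1).

Definition defect_term (z : point) (i : 'I_N.+1) : R :=
  rho i.+1 / 2 * enorm (defect z i) ^+ 2
  + mu / 2 * enorm (z.1 i - w i.+1) ^+ 2.

Lemma objective_output_expansion z :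
  objective z = objective output + \sum_(i < N.+1) defect_term z i.
Proof.
(* By stationarity the cross terms between the output and the increment
   telescope, and the boundary terms vanish: the increment is 0 at index 0
   and delta is 0 at index N+1. *)
have inc0 j : j = 0%N -> increment z j = 0.
  by move=> ->; rewrite /increment fdp_x0 subrr.
pose t j := delta j * dotmx (multiplier j) (increment z j).
have t_tele : \sum_(i < N.+1) (t i.+1 - t i) = 0.
  rewrite -(big_mkord xpredT (fun i => t i.+1 - t i)) telescope_sumr //.
  by rewrite /t (inc0 0%N) // dotmx0r mulr0 /Defs.delta ltnn mul0r subrr.
(* Adding the zero telescoping sum lets the identity be checked term by term. *)
rewrite -[RHS]addr0 -[X in _ = _ + X]t_tele /Defs.objective /defect_term.
rewrite -!big_split /=.
apply: eq_bigr => i _.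
have iN : (0 < i.+1 <= N.+1)%N by rewrite ltn_ord.
rewrite ffunE !enorm_sqr.
set e := (delta i.+1 *: state output i.+1 - _ - _ - _).
have eE : e = residual i.+1 - B i.+1 *m w i.+1.
  rewrite /e /residual [RHS]addrAC (@state_output i) -1?ltnS //.
  congr (_ - _ - _ - _).
  rewrite /Defs.delta; case: ifP => [?|_]; last by rewrite !scale0r.
  by rewrite state_output.
have -> : delta i.+1 *: state z i.+1 - A i.+1 *m state z i - B i.+1 *m z.1 i
           - c i.+1 = e + defect z i.
  rewrite eE /residual /defect /increment !mulmxBr !scalerBr.
  by apply/matrixP=> a b; rewrite !mxE; ring.
rewrite -[z.1 i in LHS](subrKC (w i.+1)) !dotmx_sqD.
have p_e : rho i.+1 * dotmx e (defect z i)
    = dotmx (multiplier i.+1) (defect z i).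
  by rewrite -dotmxZl eE -multiplier_residual.
have ti : dotmx ((A i.+1)^T *m multiplier i.+1) (increment z i) = t i.
  rewrite /t; case: (posnP i) => [i0|i_gt0]; last first.
    rewrite stationary_state ?i_gt0 -1?ltnS // /Defs.delta -ltnS ltn_ord.
    by rewrite mul1r.
  by rewrite inc0 // !dotmx0r mulr0.
(* The last term cancels the cross term from expanding [mu / 2] times the squared norm of the
   control. *)
have cross : dotmx (multiplier i.+1) (defect z i)
    = t i.+1 - t i - mu * dotmx (w i.+1) (z.1 i - w i.+1).
  rewrite /defect 2!dotmxBr dotmxZr !dotmx_trmul stationary_control // ti.
  by rewrite dotmxZl.
by move: p_e; rewrite cross => p_e; lra.
Qed.

Lemma defect_term_ge0 z i : 0 <= defect_term z i.
Proof.
by rewrite addr_ge0 // mulr_ge0 ?sqr_ge0 // divr_ge0 // ltW ?rho_gt0.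
Qed.

Lemma output_minimizer : minimizer objective output.
Proof.
move=> z; rewrite (objective_output_expansion z) lerDl.
by apply: sumr_ge0 => i _; apply: defect_term_ge0.
Qed.

Lemma minimizer_output z : minimizer objective z -> output = z.
Proof.
move=> /(_ output); rewrite objective_output_expansion gerDl => sum_le0.
have term0 (i : 'I_N.+1) : defect z i = 0 /\ z.1 i - w i.+1 = 0.
  have sum0 : \sum_i defect_term z i == 0.
    by rewrite eq_le sum_le0 sumr_ge0 // => j _; apply: defect_term_ge0.
  move: sum0; rewrite psumr_eq0 => [|j _]; last exact: defect_term_ge0.
  move=> /allP/(_ i (mem_index_enum i)); rewrite /defect_term !enorm_sqr /=.
  have rho2 : 0 < rho i.+1 / 2 by rewrite divr_gt0 ?rho_gt0.
  have mu2 : 0 < mu / 2 by rewrite divr_gt0.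
  rewrite paddr_eq0 ?(mulr_ge0 (ltW _) (dotmx_ge0 _)) // !(@mulf_eq0 _ (_ / _)).
  rewrite (gt_eqF rho2) (gt_eqF mu2).
  by move=> /andP[/eqP/dotmx_eq0 + /eqP/dotmx_eq0].
have w0 (i : 'I_N.+1) : z.1 i - w i.+1 = 0 by have [] := term0 i.
(* With equal controls, a zero defect says that each increment is [A k.+1] applied to the previous
   one, and the increment at 0 vanishes. *)
have inc0 k : (k <= N)%N -> increment z k = 0.
  elim: k => [|k IHk] kN; first by rewrite /increment fdp_x0 subrr.
  have [+ _] := term0 (Ordinal (leqW kN)); rewrite /defect w0 mulmx0 subr0 /=.
  by rewrite IHk ?(ltnW kN) // mulmx0 subr0 /Defs.delta kN scale1r.
case: z {sum_le0 term0} w0 inc0 => zw zx /= w0 inc0; congr (_, _).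
  by apply/ffunP => i; rewrite ffunE; apply/esym/subr0_eq/w0.
apply/ffunP => -[i iN]; rewrite ffunE; apply/esym/subr0_eq.
have := inc0 i.+1 iN; rewrite /increment /Defs.state.
by case: {-}_ / idP => // iN'; rewrite (bool_irrelevance iN' iN).
Qed.

End Stationarity.

Theorem lemma8 (R : realType) (N m : nat) (r s : nat -> nat) (beta mu : R)
    (x0 : 'cV[R]_(r 0%N))
    (A : forall j : nat, 'M[R]_(r j, r j.-1))
    (B : forall j : nat, 'M[R]_(r j, s j))
    (c : forall j : nat, 'cV[R]_(r j)) :
  (1 <= N)%N -> (1 <= m)%N -> 0 < beta -> 0 < mu ->
  unique (minimizer (@objective R N m r s beta mu x0 A B c))
         (@fdp_output R N m r s beta mu x0 A B c).
Proof.
move=> N_gt0 m_gt0 beta_gt0 mu_gt0; split; first exact: output_minimizer.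
by move=> z; apply: minimizer_output.
Qed.
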